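(* Let $\kappa$ be a positive rational number whose numerator and denominator (in lowest terms) are both odd and such that $\kappa<1$. Let $$F=\{x=(x_n)_{n\ge 0}\mid x_n\in\mathbb R,\ (x_{n+1})^\kappa=x_n\ \ \forall n\ge 0\},$$ with the operations $$(x+y)_n=\lim_{m\to\infty}\big(x_{n+m}+y_{n+m}\big)^{\kappa^m},\qquad (xy)_n=x_ny_n\qquad (x,y\in F).$$ Then: (1) The map $F\ni x\mapsto x_0\in\mathbb R$ is a bijection of sets and preserves the multiplicative structures. (2) The addition on $F$ defined by $(x+y)_n=\lim_{m\to\infty}\big(x_{n+m}+y_{n+m}\big)^{\kappa^m}$ is well defined but not associative. (3) Identify $F$ with $\mathbb R$ through $x\mapsto x_0$. The addition on $F$ whose graph is the limit, as $m\to\infty$, of the graphs $$G_m=\{(a,b,c)\in\mathbb R^3\mid c=(a^{\kappa^{-m}}+b^{\kappa^{-m}})^{\kappa^m}\}$$ (as closed subsets of $\mathbb R\times\mathbb R\times\mathbb R$) is multivalued, associative, and defines (together with the multiplication) a hyperfield structure on $F$, which coincides with the real tropical hyperfield $\mathbb R^\flat$.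
   Context: For a positive rational $\lambda$ with odd numerator and odd denominator, $t\mapsto t^\lambda$ denotes the bijection $t\mapsto \mathrm{sign}(t)|t|^\lambda$ of $\mathbb R$ (with $0\mapsto 0$). A hyperfield is a set $H$ with distinct elements $0,1$, a commutative associative multiplication for which $H\setminus\{0\}$ is an abelian group with unit $1$ and $0\cdot x=0$, and a multivalued addition $(x,y)\mapsto x+y$ with values non-empty subsets of $H$, which is commutative, associative ($(x+y)+z=x+(y+z)$, where $A+B=\bigcup_{a\in A,b\in B}(a+b)$), satisfies $x+0=\{x\}$, has for each $x$ a unique element $-x$ with $0\in x+(-x)$, satisfies $x\in y+z\Rightarrow z\in x+(-y)$, and is distributive: $x(y+z)=xy+xz$. The real tropical hyperfield $\mathbb R^\flat$ is the set $\mathbb R$ with its usual multiplication and the hyperaddition $$x\smile y=\begin{cases} x & \text{if } |x|>|y| \text{ or } x=y,\\ y&\text{if } |x|<|y|\text{ or } x=y,\\ [-|x|,|x|]&\text{if } y=-x.\end{cases}$$ The limit of closed subsets of $\mathbb R^3$ is taken in the sense of closed (Painlevé–Kuratowski) convergence: the limit set consists of the limits of convergent sequences $p_m\in G_m$, and every accumulation point of a sequence $p_m\in G_m$ belongs to it. *)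

(* Defs.v *)
From HB Require Import structures.
From mathcomp Require Import all_boot all_order all_algebra.
From mathcomp Require Import all_classical all_reals all_analysis.

Set Implicit Arguments.
Unset Strict Implicit.
Unset Printing Implicit Defensive.

Import Order.TTheory GRing.Theory Num.Theory.
Import numFieldNormedType.Exports.

Local Open Scope classical_set_scope.
Local Open Scope ring_scope.

(* An odd function of t, hence the intended bijection of R only when the
   numerator and the denominator of lam are odd and lam is positive. *)
Definition spow (R : realType) (lam : rat) (t : R) : R :=
  Num.sg t * `|t| `^ ratr lam.

Lemma spow0 (R : realType) (lam : rat) : spow lam (0 : R) = 0.
Proof. by rewrite /spow sgr0 mul0r. Qed.

Lemma spow1 (R : realType) (lam : rat) : spow lam (1 : R) = 1.
Proof. by rewrite /spow sgr1 normr1 powR1 mul1r. Qed.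

Lemma spowM (R : realType) (lam : rat) (s t : R) :
  spow lam (s * t) = spow lam s * spow lam t.
Proof. by rewrite /spow sgrM normrM powRM ?normr_ge0 // mulrACA. Qed.

Record Fseq (R : realType) (kappa : rat) := MkFseq {
  Fval :> nat -> R;
  FvalP : forall n, spow kappa (Fval n.+1) = Fval n
}.

Definition Fzero (R : realType) (kappa : rat) : Fseq R kappa :=
  MkFseq (fun=> spow0 R kappa).

Definition Fone (R : realType) (kappa : rat) : Fseq R kappa :=
  MkFseq (fun=> spow1 R kappa).

Lemma Fmul_subproof (R : realType) (kappa : rat) (x y : Fseq R kappa) (n : nat) :
  spow kappa (x n.+1 * y n.+1) = x n * y n.
Proof. by rewrite spowM !FvalP. Qed.

Definition Fmul (R : realType) (kappa : rat) (x y : Fseq R kappa) : Fseq R kappa :=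
  MkFseq (Fmul_subproof x y).

Definition ev0 (R : realType) (kappa : rat) (x : Fseq R kappa) : R := x 0%N.

(* (x + y)_n is the limit of this sequence as m goes to infinity. *)
Definition Fadd_approx (R : realType) (kappa : rat) (x y : Fseq R kappa)
    (n m : nat) : R :=
  spow (kappa ^+ m) (x (n + m)%N + y (n + m)%N).

Definition hadd_set (H : Type) (hadd : H -> H -> set H) (A B : set H) : set H :=
  \bigcup_(a in A) \bigcup_(b in B) hadd a b.

Definition hassociative (H : Type) (hadd : H -> H -> set H) : Prop :=
  forall x y z,
    hadd_set hadd (hadd x y) [set z] = hadd_set hadd [set x] (hadd y z).

Definition multivalued (H : Type) (hadd : H -> H -> set H) : Prop :=
  exists x y a b, [/\ hadd x y a, hadd x y b & a <> b].

Record is_hyperfield (H : Type) (zero one : H) (mul : H -> H -> H)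
    (hadd : H -> H -> set H) : Prop := IsHyperfield {
  hf_one_neq0 : one <> zero;
  hf_mulA : associative mul;
  hf_mulC : commutative mul;
  hf_mul1 : left_id one mul;
  hf_mul0 : left_zero zero mul;
  hf_mul_neq0 : forall x y, x <> zero -> y <> zero -> mul x y <> zero;
  hf_inv : forall x, x <> zero -> exists2 y, y <> zero & mul x y = one;
  hf_add_nonempty : forall x y, hadd x y !=set0;
  hf_addC : commutative hadd;
  hf_addA : hassociative hadd;
  hf_add0 : forall x, hadd x zero = [set x];
  hf_opp : forall x, exists! y, hadd x y zero;
  (* y' is - y *)
  hf_reversible : forall x y z y',
    hadd y y' zero -> hadd y z x -> hadd x y' z;
  hf_mulDr : forall x y z, mul x @` hadd y z = hadd (mul x y) (mul x z)
}.

Record is_hyperfield_iso (H K : Type)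
    (zeroH oneH : H) (mulH : H -> H -> H) (haddH : H -> H -> set H)
    (zeroK oneK : K) (mulK : K -> K -> K) (haddK : K -> K -> set K)
    (f : H -> K) : Prop := IsHyperfieldIso {
  hfi_bij : bijective f;
  hfi_zero : f zeroH = zeroK;
  hfi_one : f oneH = oneK;
  hfi_mul : {morph f : x y / mulH x y >-> mulK x y};
  hfi_add : forall x y, f @` haddH x y = haddK (f x) (f y)
}.

Definition trop_add (R : realType) (x y : R) : set R :=
  [set z | [\/ (`|x| > `|y| \/ x = y) /\ z = x,
               (`|x| < `|y| \/ x = y) /\ z = y |
               y = - x /\ z \in `[- `|x|, `|x|] ]].

(* Painleve-Kuratowski convergence. *)
Definition PK_cvg (T : topologicalType) (G : nat -> set T) (L : set T) : Prop :=
  (forall p, L p <->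
     exists u : nat -> T, (forall m, G m (u m)) /\ u @ \oo --> p) /\
  (forall (u : nat -> T) p,
     (forall m, G m (u m)) -> cluster (u @ \oo) p -> L p).

Definition add_graph (R : realType) (kappa : rat) (m : nat) : set (R * R * R) :=
  [set p | p.2 = spow (kappa ^+ m)
                   (spow (kappa ^- m) p.1.1 + spow (kappa ^- m) p.1.2)].

Definition Fgraph (R : realType) (kappa : rat)
    (hadd : Fseq R kappa -> Fseq R kappa -> set (Fseq R kappa)) :
    set (R * R * R) :=
  [set p | exists x y z, hadd x y z /\ p = (ev0 x, ev0 y, ev0 z)].

(* Main.v *)
Require Import Defs.
From HB Require Import structures.
From mathcomp Require Import all_boot all_order all_algebra.
From mathcomp Require Import all_classical all_reals all_analysis.
From mathcomp Require Import lra.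

Set Implicit Arguments.
Unset Strict Implicit.
Unset Printing Implicit Defensive.

Import Order.TTheory GRing.Theory Num.Theory.
Import numFieldNormedType.Exports.

Local Open Scope classical_set_scope.
Local Open Scope ring_scope.

(** Write [x [l]] for the signed power of [x] with exponent [l].  A point
[(a, b, c)] lies on the graph [G_m] exactly when, with [l = kappa ^- m], the
numbers [x = a], [y = b], [z = - c] satisfy [x [l] + y [l] + z [l] = 0].  Since
[- x [l] = y [l] + z [l]] is at most twice the [l]-th power of
[max (y, z)], such a triple satisfies
  [max (x, y, z) <= K_m * max (- x, - y, - z)]
and the opposite inequality, where [K_m] is [2] to the power [kappa ^+ m] and
tends to [1] (lemma [deformed_add_max3]).  Every accumulation point of points
of the [G_m] is therefore balanced: [max (x, y, z) = max (- x, - y, - z)], that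
is, the largest absolute value in the triple occurs with both signs.  This is
the tropical form of [x + y + z = 0], and it says precisely that [c] belongs to
the tropical sum of [a] and [b] (lemma [trop_addE]).

Conversely every point [(a, b, c)] of the tropical graph is a limit (lemma
[add_graph_approx]).  If [b <> - a], the tropical sum of [a] and [b] is the
singleton [c]; the values [c_m] of the deformed sums of [a] and [b] stay in a
compact interval and accumulate only at [c], hence tend to it.  If [b = - a]
and [c <> a], the equation is solved for [b] instead: as [|c| <= |a|], the
tropical difference [c - a] is the singleton [- a].  The remaining point
[(a, - a, a)] is the limit of [(K_m a, - a, a)].

The balanced form makes the hyperfield axioms nearly symmetric in all variables.
In particular [w] belongs to [(x + y) + z] if and only if the quadruple
[x, y, z, - w] is balanced (lemma [balanced_glue]), a condition that does not
see the bracketing; this is associativity.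

A sequence [x] of iterated roots is determined by [x_0], namely
[x_n = x_0 [kappa ^- n]], so [x |-> x_0] is a multiplicative bijection onto the
reals, through which everything is transported.  The approximants of [(x + y)_n]
are the deformed sums of [x_n] and [y_n]; they tend to the term of larger
absolute value, or to [0] when the terms are opposite.  That limiting addition is
not associative: [(1 + 1) + (- 1) = 0] whereas [1 + (1 + (- 1)) = 1]. *)

(** * Signed powers *)

Section SignedPower.
Variable R : realType.
Implicit Types (lam mu : rat) (s t x y z : R).

Lemma spowN lam t : spow lam (- t) = - spow lam t.
Proof. by rewrite /spow sgrN normrN mulNr. Qed.

Lemma spow_pos lam t : 0 < t -> spow lam t = t `^ ratr lam.
Proof. by move=> t0; rewrite /spow gtr0_sg // gtr0_norm // mul1r. Qed.

Lemma spow_gt0 lam t : 0 < t -> 0 < spow lam t.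
Proof. by move=> t0; rewrite spow_pos // powR_gt0. Qed.

Lemma norm_spow lam t : `|spow lam t| = spow lam `|t|.
Proof.
have [->|t0] := eqVneq t 0; first by rewrite spow0 normr0 spow0.
rewrite [RHS]spow_pos ?normr_gt0 // /spow normrM normr_sg t0 mul1r.
by rewrite ger0_norm ?powR_ge0.
Qed.

Lemma spow_comp lam mu t : spow lam (spow mu t) = spow (lam * mu) t.
Proof.
wlog t_gt0 : t / 0 < t => [pos|].
  have [/pos //|t_lt0|<-] := ltrgtP 0 t; last by rewrite !spow0.
  by apply: oppr_inj; rewrite -!spowN; apply: pos; rewrite oppr_gt0.
by rewrite !spow_pos ?powR_gt0 // -powRrM rmorphM mulrC.
Qed.

Lemma spow_1l t : spow 1 t = t.
Proof. by rewrite /spow rmorph1 powRr1 ?normr_ge0 // -numEsg. Qed.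

Lemma spowK lam : lam != 0 -> cancel (@spow R lam) (spow lam^-1).
Proof. by move=> lam0 t; rewrite spow_comp mulVf // spow_1l. Qed.

Lemma spowVK lam : lam != 0 -> cancel (@spow R lam^-1) (spow lam).
Proof. by move=> lam0 t; rewrite spow_comp mulfV // spow_1l. Qed.

Lemma spow_homo_lt lam : 0 < lam -> {homo @spow R lam : s t / s < t}.
Proof.
move=> lam_gt0.
have pos s t : 0 < s -> s < t -> spow lam s < spow lam t.
  move=> s0 st; have t0 := lt_trans s0 st.
  by rewrite !spow_pos // gt0_ltr_powR ?ltr0q // nnegrE ltW.
move=> s t st; have [s0|s0|s0] := ltrgtP 0 s.
- exact: pos.
- have [t0|t0|<-] := ltrgtP 0 t.
  + apply: (@lt_trans _ _ 0); last exact: spow_gt0.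
    by rewrite -oppr_gt0 -spowN spow_gt0 // oppr_gt0.
  + by rewrite -ltrN2 -!spowN pos ?oppr_gt0 // ltrN2.
  + by rewrite spow0 -oppr_gt0 -spowN spow_gt0 // oppr_gt0.
- by rewrite -s0 spow0 spow_gt0 // s0.
Qed.

Lemma spow_mono_le lam : 0 < lam -> {mono @spow R lam : s t / s <= t}.
Proof. by move=> lam_gt0; apply/le_mono/spow_homo_lt. Qed.

(** An increasing bijection is continuous: the preimage of an interval around
the image is the interval between the preimages of its endpoints. *)
Lemma spow_continuous lam : 0 < lam -> continuous (@spow R lam).
Proof.
move=> lam_gt0 x; apply/cvgrPdist_lt => e e_gt0.
have lam0 : lam != 0 by rewrite gt_eqF.
have lt := spow_homo_lt (etrans (invr_gt0 lam) lam_gt0).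
near=> t.
have : spow lam^-1 (spow lam x - e) < t < spow lam^-1 (spow lam x + e).
  near: t; apply: near_in_itvoo; rewrite in_itv /=.
  apply/andP; split; [rewrite -[ltRHS](spowK lam0)|rewrite -[ltLHS](spowK lam0)].
    by apply: lt; lra.
  by apply: lt; lra.
case/andP => /(spow_homo_lt lam_gt0) + /(spow_homo_lt lam_gt0).
rewrite !spowVK // => ? ?; rewrite ltr_norml; apply/andP; split; lra.
Unshelve. all: by end_near. Qed.

(** Since [0 < kappa < 1], the exponent [kappa ^+ m] tends to [0]. *)
Lemma spow2_cvg1 (kappa : rat) : 0 < kappa -> kappa < 1 ->
  spow (kappa ^+ m) (2 : R) @[m --> \oo] --> (1 : R).
Proof.
move=> kappa_gt0 kappa_lt1.
under eq_fun do rewrite spow_pos // /powR pnatr_eq0 /= rmorphXn.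
suff : expR (ratr kappa ^+ m * ln 2 : R) @[m --> \oo] --> expR (0 * ln 2 : R).
  by rewrite mul0r expR0.
apply: continuous_cvg; first exact: continuous_expR.
apply: cvgMr_tmp; apply: cvg_expr.
by rewrite ger0_norm ?ler0q ?ltW // -(rmorph1 (@ratr R)) ltr_rat.
Qed.

End SignedPower.

(** * The real tropical hyperfield *)

Section Tropical.
Variable R : realType.
Implicit Types a b c k s w x y z : R.

Definition max3 x y z : R := Num.max (Num.max x y) z.

(** Case analysis on which entry is the largest leaves only linear arithmetic
in the goals below. *)
Variant max3_spec x y z : R -> Prop :=
  | Max3Fst of y <= x & z <= x : max3_spec x y z x
  | Max3Snd of x <= y & z <= y : max3_spec x y z y
  | Max3Trd of x <= z & y <= z : max3_spec x y z z.

Lemma max3P x y z : max3_spec x y z (max3 x y z).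
Proof.
rewrite /max3; case: (leP x y) => xy; case: leP => ?; constructor => //; lra.
Qed.

Lemma max3_ge x y z :
  [/\ x <= max3 x y z, y <= max3 x y z & z <= max3 x y z].
Proof. by rewrite /max3 !le_max !lexx ?orbT. Qed.

(** The tropical counterpart of [x + y + z = 0]: the largest absolute value
occurs among the entries with both signs. *)
Definition balanced x y z : Prop := max3 x y z = max3 (- x) (- y) (- z).

Lemma balancedN x y z : balanced x y z -> balanced (- x) (- y) (- z).
Proof. by rewrite /balanced !opprK => ->. Qed.

Lemma balancedC x y z : balanced x y z -> balanced y x z.
Proof. by rewrite /balanced /max3 (maxC x) (maxC (- x)). Qed.

Lemma balanced_rot x y z : balanced x y z -> balanced y z x.
Proof.
have rot u v w : max3 u v w = max3 v w u by rewrite /max3 -maxA maxC.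
by rewrite /balanced !(rot x, rot (- x)).
Qed.

Lemma balanced_opp x y : `|y| <= `|x| -> balanced x y (- x).
Proof.
rewrite ler_norml => /andP[]; rewrite /balanced.
by case: (ger0P x) => ? ? ?; case: max3P => ? ?; case: max3P => ? ?; lra.
Qed.

(** The largest entry and the largest opposite of an entry have the same value,
hence come from two entries that are opposite and dominate the third one. *)
Lemma balanced_pair x y z : balanced x y z ->
  [\/ z = - x /\ `|y| <= `|x|, z = - y /\ `|x| <= `|y| |
      y = - x /\ `|z| <= `|x|].
Proof.
have le_norm (u v : R) : - v <= u -> u <= v -> `|u| <= `|v|.
  by move=> vu uv; rewrite (le_trans _ (ler_norm v)) // ler_norml vu.
have le_normN (u v : R) : v <= u -> u <= - v -> `|u| <= `|v|.
  by move=> vu uv; rewrite -(normrN v) le_norm ?opprK.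
rewrite /balanced; case: max3P => ? ?; case: max3P => ? ? e.
- by apply: Or31; split; [|apply: le_norm]; lra.
- by apply: Or33; split; [|apply: le_norm]; lra.
- by apply: Or31; split; [|apply: le_norm]; lra.
- by apply: Or33; split; [|apply: le_normN]; lra.
- by apply: Or32; split; [|apply: le_norm]; lra.
- by apply: Or32; split; [|apply: le_norm]; lra.
- by apply: Or31; split; [|apply: le_normN]; lra.
- by apply: Or32; split; [|apply: le_normN]; lra.
- by apply: Or31; split; [|apply: le_norm]; lra.
Qed.

(** Membership in a tropical sum becomes a condition symmetric in [x], [y] and
[- z]; the hyperfield axioms and the passage to the limit use it in this form. *)
Lemma trop_addE x y z : trop_add x y z <-> balanced x y (- z).
Proof.
rewrite /trop_add /= in_itv /= -ler_norml; split.
  case=> [[le_yx ->]|[le_xy ->]|[-> le_zx]].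
  - by apply: balanced_opp; case: le_yx => [/ltW|->].
  - by apply/balancedC/balanced_opp; case: le_xy => [/ltW|->].
  - by apply/balancedC/balanced_rot/balanced_rot/balanced_opp; rewrite normrN.
case/balanced_pair=> [] [/eqP].
- rewrite eqr_opp le_eqVlt => /eqP -> /orP[|yx]; last by apply: Or31; split; [left|].
  rewrite eqr_norm2 => /orP[/eqP ->|/eqP ->]; first by apply: Or31; split; [right|].
  by apply: Or33.
- rewrite eqr_opp le_eqVlt => /eqP -> /orP[|yx]; last by apply: Or32; split; [left|].
  rewrite eqr_norm2 => /orP[/eqP ->|/eqP ->]; first by apply: Or32; split; [right|].
  by apply: Or33; rewrite normrN opprK.
- by move=> /eqP -> zx; apply: Or33; rewrite normrN in zx *.
Qed.

End Tropical.

Section TropicalHyperfield.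
Variable R : realType.
Implicit Types a b c k s t w x y z : R.

(** The pairs [(p, n)] and [(q, m)] stand for the maxima of two groups of
numbers and of their opposites.  For the converse, if one of the pairs has
[p <> n], then [s] is forced up to sign to be its larger member; if [p = n] and
[q = m], then [s = 0] works. *)
Lemma max_glue (p n q m : R) : - n <= p -> - m <= q ->
  (exists s, Num.max p (- s) = Num.max n s /\ Num.max q s = Num.max m (- s)) <->
  Num.max p q = Num.max n m.
Proof.
move=> np mq.
have pn : - p <= n by rewrite lerNl.
have qm : - q <= m by rewrite lerNl.
split=> [[s [ps qs]]|e].
  (* Exchanging the two groups, or changing all signs, permutes the hypotheses,
     so one inequality yields the four that make up the equality. *)
  have bound (a b c r : R) : - b <= a ->
      a <= Num.max b r -> r <= Num.max c (- r) -> a <= Num.max b c.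
    move=> ba; rewrite !le_max => /orP[-> //|ar] /orP[rc|r0].
      by rewrite (le_trans ar rc) orbT.
    by apply/orP; left; lra.
  apply/le_anti; rewrite !ge_max -!andbA; apply/and4P; split.
  - by apply: (@bound _ _ _ s) => //; rewrite -?ps -?qs le_max lexx ?orbT.
  - by rewrite maxC; apply: (@bound _ _ _ (- s)) => //;
    rewrite ?opprK -?ps -?qs le_max lexx ?orbT.
  - by apply: (@bound _ _ _ (- s)) => //;
    rewrite ?opprK ?ps ?qs le_max lexx ?orbT.
  - by rewrite maxC; apply: (@bound _ _ _ s) => //;
    rewrite ?ps ?qs le_max lexx ?orbT.
(* The same symmetries reduce the choice of [s] to a single case. *)
have dominant (a b c d : R) : - b <= a -> b < a -> Num.max a c = Num.max b d ->
    Num.max a (- a) = Num.max b a /\ Num.max c a = Num.max d (- a).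
  move=> ba lt_ba acbd; have le_ad : a <= d.
    have : a <= Num.max b d by rewrite -acbd le_max lexx.
    by rewrite le_max => /orP[]; lra.
  rewrite (maxC c) acbd (@max_l _ _ a) 1?(@max_r _ _ b a) ?(@max_r _ _ b d);
  by rewrite ?(@max_l _ _ d); try lra.
have [pn'|np'|en] := ltrgtP p n.
- by have [? ?] := dominant n p m q pn pn' (esym e); exists (- n); rewrite opprK.
- by have [? ?] := dominant p n q m np np' e; exists p.
subst n; have [qm'|mq'|<-] := ltrgtP q m; last by exists 0; rewrite oppr0.
- have [|? ?] := dominant m q p p qm qm'; first by rewrite maxC -e maxC.
  by exists m.
have [|? ?] := dominant q m p p mq mq'; first by rewrite maxC e maxC.
by exists (- q); rewrite opprK.
Qed.

(** Eliminating the intermediate sum [s]: both sides say that the quadruple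
[x, y, z, t] is balanced, which no longer depends on how it was split. *)
Lemma balanced_glue x y z t :
  (exists s, balanced x y (- s) /\ balanced z t s) <->
  Num.max (Num.max x y) (Num.max z t) =
  Num.max (Num.max (- x) (- y)) (Num.max (- z) (- t)).
Proof.
have opp_max (u v : R) : - Num.max (- u) (- v) <= Num.max u v.
  by case: (leP u v) => ?; case: (leP (- u) (- v)) => ?; lra.
rewrite -(max_glue (opp_max x y) (opp_max z t)) /balanced /max3.
by split=> -[s [xy zt]]; exists s; rewrite opprK in xy *.
Qed.

Lemma trop_addC : commutative (@trop_add R).
Proof.
by move=> x y; apply/seteqP; split=> z /trop_addE/balancedC/trop_addE.
Qed.

(** With [t = - w], the balanced quadruple [x, y, z, t] is split as [xy|zt] for
one bracketing and as [yz|xt] for the other. *)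
Lemma trop_addA : hassociative (@trop_add R).
Proof.
have maxACA (a b c d : R) :
    Num.max (Num.max a b) (Num.max c d) = Num.max (Num.max b c) (Num.max a d).
  by rewrite -!maxA maxCA; congr Num.max; rewrite maxCA.
move=> x y z; apply/seteqP; split=> w.
  move=> [s /trop_addE xys] [_ -> /trop_addE szw].
  have /balanced_glue : exists s, balanced x y (- s) /\ balanced z (- w) s.
    by exists s; split=> //; apply: balanced_rot.
  rewrite maxACA [in X in _ = X]maxACA => /balanced_glue[r [yzr xwr]].
  exists x => //; exists r; first exact/trop_addE.
  by apply/trop_addE/balancedC/balanced_rot/balanced_rot.
move=> [_ ->] [s /trop_addE yzs] /trop_addE xsw.
have /balanced_glue : exists s, balanced y z (- s) /\ balanced x (- w) s.
  by exists s; split=> //; apply/balanced_rot/balancedC.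
rewrite -maxACA -[in X in _ = X]maxACA => /balanced_glue[r [xyr zwr]].
exists r; first exact/trop_addE.
by exists z => //; apply/trop_addE/balanced_rot/balanced_rot.
Qed.

Lemma trop_add_nonempty x y : trop_add x y !=set0.
Proof.
have [xy|xy|/eqP] := ltrgtP `|x| `|y|.
- by exists y; apply: Or32; split; [left|].
- by exists x; apply: Or31; split; [left|].
rewrite eqr_norm2 => /orP[/eqP ->|/eqP ->].
  by exists y; apply: Or31; split; [right|].
by exists 0; apply: Or33; rewrite opprK in_itv /= oppr_le0 normr_ge0.
Qed.

Lemma trop_add_dominant x y :
  `|y| <= `|x| -> x + y != 0 -> trop_add x y = [set x].
Proof.
move=> yx xy0; apply/seteqP; split=> z.
  case=> [[_ //]|[[|-> //]]|[e]]; first by rewrite ltNge yx.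
  by rewrite e subrr eqxx in xy0.
move=> ->; case: (ltgtP `|x| `|y|) yx => // [yx _|/eqP + _].
  by apply: Or31; split; [left|].
rewrite eqr_norm2 => /orP[/eqP ->|/eqP e]; first by apply: Or31; split; [right|].
by rewrite e addNr eqxx in xy0.
Qed.

Lemma trop_add0 x : trop_add x 0 = [set x].
Proof.
apply/seteqP; split=> z; rewrite /trop_add /= normr0.
  case=> [[_ ->]|[[x0|->] ->]|[/esym/eqP]] //.
    by rewrite ltNge normr_ge0 in x0.
  by rewrite oppr_eq0 => /eqP ->; rewrite in_itv /= normr0 oppr0 => /le_anti.
move=> ->; apply: Or31; split => //; have [->|x0] := eqVneq x 0; first by right.
by left; rewrite normr_gt0.
Qed.

Lemma trop_add_opp x y : trop_add x y 0 <-> y = - x.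
Proof.
split; last first.
  by move=> ->; apply: Or33; rewrite in_itv /= oppr_le0 normr_ge0.
case=> [[+ x0]|[+ y0]|[]//]; first rewrite -x0 normr0 oppr0.
  by case; [rewrite ltNge normr_ge0|].
by rewrite -y0 normr0; case; [rewrite ltNge normr_ge0|move=> ->; rewrite oppr0].
Qed.

Lemma trop_add_reversible x y z : trop_add y z x -> trop_add x (- y) z.
Proof.
move=> /trop_addE/balancedN; rewrite opprK => yzx.
exact/trop_addE/balanced_rot/balanced_rot.
Qed.

Lemma trop_addZ k x y z :
  k != 0 -> trop_add x y z -> trop_add (k * x) (k * y) (k * z).
Proof.
rewrite -normr_gt0 /trop_add /= !in_itv /= -!ler_norml !normrM => k_gt0.
rewrite !ltr_pM2l // ler_pM2l // -mulrN.
by case=> [[h ->]|[h ->]|[-> h]];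
  [apply: Or31|apply: Or32|apply: Or33]; split=> //;
  (by case: h => [h|->]; [left|right]).
Qed.

Lemma trop_addMr k x y : *%R k @` trop_add x y = trop_add (k * x) (k * y).
Proof.
have [->|k0] := eqVneq k 0.
  rewrite !mul0r trop_add0; apply/seteqP; split=> [_ [z _ <-]|_ ->] /=.
    by rewrite mul0r.
  by have [z xyz] := trop_add_nonempty x y; exists z; rewrite ?mul0r.
apply/seteqP; split=> [_ [z xyz <-]|z xyz]; first exact: trop_addZ.
exists (k^-1 * z); last by rewrite mulVKf.
by rewrite -(mulKf k0 x) -(mulKf k0 y); apply: trop_addZ; rewrite ?invr_eq0.
Qed.

Lemma trop_multivalued : multivalued (@trop_add R).
Proof.
exists 1, (- 1), 0, 1; split; first exact/trop_add_opp.
  by apply: Or33; rewrite normr1 in_itv /= lexx andbT; split=> //; lra.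
by apply/eqP; rewrite eq_sym oner_eq0.
Qed.

Lemma trop_hyperfield : is_hyperfield 0 1 *%R (@trop_add R).
Proof.
split.
- by apply/eqP; rewrite oner_eq0.
- exact: mulrA.
- exact: mulrC.
- exact: mul1r.
- exact: mul0r.
- by move=> x y /eqP x0 /eqP y0; apply/eqP; rewrite mulf_neq0.
- move=> x /eqP x0; exists x^-1; last exact: mulfV.
  by apply/eqP; rewrite invr_eq0.
- exact: trop_add_nonempty.
- exact: trop_addC.
- exact: trop_addA.
- exact: trop_add0.
- by move=> x; exists (- x); split=> [|y]; rewrite trop_add_opp.
- move=> x y z _ /trop_add_opp ->; exact: trop_add_reversible.
- exact: trop_addMr.
Qed.

End TropicalHyperfield.

(** * Deformed additions and their limit *)

Section DeformedAddition.
Variable R : realType.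
Implicit Types (lam : rat) (a b c k x y z : R).

(** The addition of the reals transported along the signed power of exponent
[lam]; the tropical addition is its degeneration as [lam] tends to [0]. *)
Definition deformed_add lam a b : R :=
  spow lam (spow lam^-1 a + spow lam^-1 b).

(** Each of the three summands is the sum of the opposites of the two others,
hence at most twice the power of the largest opposite. *)
Lemma zero_sum_max3 lam x y z : 0 < lam ->
  spow lam^-1 x + spow lam^-1 y + spow lam^-1 z = 0 ->
  max3 x y z <= spow lam 2 * max3 (- x) (- y) (- z).
Proof.
move=> lam_gt0 sum0; set M := max3 (- x) (- y) (- z).
have mono := spow_mono_le (etrans (invr_gt0 lam) lam_gt0).
have spow_le_max u : - u <= M -> - spow lam^-1 u <= spow lam^-1 M.
  by rewrite -spowN mono.
have [/spow_le_max xM /spow_le_max yM /spow_le_max zM] :=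
  max3_ge (- x) (- y) (- z).
rewrite -mono spowM (spowK (lt0r_neq0 lam_gt0)).
move: xM yM zM sum0; case: max3P => _ _;
  move: (spow _ x) (spow _ y) (spow _ z) (spow _ M) => sx sy sz sM; lra.
Qed.

Lemma deformed_add_max3 lam a b c : 0 < lam -> c = deformed_add lam a b ->
  max3 a b (- c) <= spow lam 2 * max3 (- a) (- b) c /\
  max3 (- a) (- b) c <= spow lam 2 * max3 a b (- c).
Proof.
move=> lam_gt0 /(congr1 (spow lam^-1)); rewrite spowK ?gt_eqF // => e.
split; last rewrite -[a in leRHS]opprK -[b in leRHS]opprK.
  rewrite -[c in leRHS]opprK; apply: zero_sum_max3 => //.
  by rewrite spowN e subrr.
by apply: zero_sum_max3 => //; rewrite !spowN e; lra.
Qed.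

(** Allows an inequality with a varying constant [k m] to pass to the limit
along an accumulation point of [u]. *)
Lemma cluster_pair (S T : topologicalType) (k : nat -> S) (u : nat -> T) s p :
  k @ \oo --> s -> cluster (u @ \oo) p ->
  cluster ((k m, u m) @[m --> \oo]) (s, p).
Proof.
move=> ks up A B /= FA [[B1 B2] /= [sB1 pB2] subB].
have [] := up [set v | exists2 m, v = u m & A (k m, u m) /\ B1 (k m)] B2 _ pB2.
  have kB1 : \forall m \near \oo, B1 (k m) by exact: ks.
  by apply: filterS2 FA kB1 => m Akm Bkm; exists m.
move=> _ [[m -> [Akm Bkm]] B2um]; exists (k m, u m); split=> //.
exact: (subB (k m, u m)).
Qed.

Lemma cluster_le (T : topologicalType) (f g : T -> R) (u : nat -> T) p :
  continuous f -> continuous g -> (forall m, f (u m) <= g (u m)) ->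
  cluster (u @ \oo) p -> f p <= g p.
Proof.
move=> fc gc fg; rewrite clusterE => /(_ [set q | f q <= g q]).
suff /closure_id <- : closed [set q | f q <= g q].
  by apply; apply: (@filterE nat \oo).
rewrite (_ : [set q | f q <= g q] = (fun q => g q - f q) @^-1` [set r | 0 <= r]).
  apply: closed_comp => [q _|]; last exact: closed_ge.
  by apply: continuousB; [exact: gc|exact: fc].
by apply/seteqP; split=> q /=; rewrite subr_ge0.
Qed.

Lemma max3_continuous (T : topologicalType) (f g h : T -> R) :
  continuous f -> continuous g -> continuous h ->
  continuous (fun q => max3 (f q) (g q) (h q)).
Proof.
move=> fc gc hc q; apply: (@continuous_max R T _ h); last exact: hc.
by apply: (@continuous_max R T f g); [exact: fc|exact: gc].
Qed.

Definition trop_graph : set (R * R * R) := [set p | trop_add p.1.1 p.1.2 p.2].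

Variable kappa : rat.
Hypotheses (kappa_gt0 : 0 < kappa) (kappa_lt1 : kappa < 1).

(** The bounds of [deformed_add_max3] are closed conditions on the constant
and the point together; at the limit the constant is [1] and the two
inequalities become the equality of maxima. *)
Lemma add_graph_cluster (u : nat -> R * R * R) p :
  (forall m, add_graph kappa m (u m)) -> cluster (u @ \oo) p -> trop_graph p.
Proof.
move=> Gu /(cluster_pair (@spow2_cvg1 R _ kappa_gt0 kappa_lt1)) up.
have bound m := deformed_add_max3 (exprn_gt0 m kappa_gt0) (Gu m).
apply/trop_addE; apply/le_anti; rewrite opprK.
rewrite -[X in _ && (_ <= X)]mul1r -[X in (_ <= X) && _]mul1r.
have comp (S T U : topologicalType) (f : S -> T) (g : T -> U) :
    continuous f -> continuous g -> continuous (g \o f).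
  by move=> fc gc q; apply: continuous_comp; [exact: fc|exact: gc].
have cfst (S T : topologicalType) : continuous (@fst S T).
  by move=> q; exact: cvg_fst.
have csnd (S T : topologicalType) : continuous (@snd S T).
  by move=> q; exact: cvg_snd.
have c1 : continuous (fun q : R * (R * R * R) => q.2.1.1).
  exact: comp (comp _ _ _ _ _ (csnd _ _) (cfst _ _)) (cfst _ _).
have c2 : continuous (fun q : R * (R * R * R) => q.2.1.2).
  exact: comp (comp _ _ _ _ _ (csnd _ _) (cfst _ _)) (csnd _ _).
have c3 : continuous (fun q : R * (R * R * R) => q.2.2).
  exact: comp (csnd _ _) (csnd _ _).
have cN (f : R * (R * R * R) -> R) : continuous f -> continuous (fun q => - f q).
  by move=> fc q; apply: continuousN; exact: fc.
have cM (f : R * (R * R * R) -> R) : continuous f ->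
    continuous (fun q : R * (R * R * R) => q.1 * f q).
  by move=> fc q; apply: continuousM; [exact: cvg_fst|exact: fc].
have cp := max3_continuous c1 c2 (cN _ c3).
have cn := max3_continuous (cN _ c1) (cN _ c2) c3.
apply/andP; split.
- by apply: (cluster_le cp (cM _ cn) _ up) => m; case: (bound m).
- by apply: (cluster_le cn (cM _ cp) _ up) => m; case: (bound m).
Qed.

(** Uniform in [m], so that the deformed sums of [a] and [b] stay in a compact
set. *)
Lemma deformed_add_bound m a b :
  `|deformed_add (kappa ^+ m) a b| <= 2 * (`|a| + `|b|).
Proof.
set c := deformed_add _ _ _.
have [] := deformed_add_max3 (exprn_gt0 m kappa_gt0) (erefl c).
have : spow (kappa ^+ m) 2 <= 2 :> R.
  rewrite spow_pos // ler1_powR ?ler1n // -(rmorph1 (@ratr R)) ler_rat.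
  by rewrite exprn_ile1 ?ltW.
have : 0 < spow (kappa ^+ m) 2 :> R by rewrite spow_gt0.
move: (spow _ _) c (ler_norm a) (ler_norm (- a)) (ler_norm b) (ler_norm (- b)).
rewrite !normrN => K c; move: `|a| `|b| => A B aA aB bA bB K0 K2 le1 le2.
(* Either the bounding maximum is one of [a], [b] up to sign, or
   [d <= - K * d], which forces [d <= 0]. *)
have bound d r : d <= K * r -> r <= A + B \/ r = - d -> d <= 2 * (A + B).
  move=> dr [rAB|e].
    apply: le_trans dr _; apply: (@le_trans _ _ (K * (A + B))).
      by rewrite ler_wpM2l // ltW.
    by rewrite ler_wpM2r //; lra.
  have [d0|d0] := leP d 0; first lra.
  by have := mulr_gt0 K0 d0; rewrite e mulrN in dr; lra.
have [_ _ c1] := max3_ge a b (- c); have [_ _ c2] := max3_ge (- a) (- b) c.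
rewrite ler_norml lerNl; apply/andP; split.
  apply: (bound _ (max3 (- a) (- b) c)); first exact: le_trans c1 le1.
  by case: max3P => _ _; [left|left|right]; lra.
apply: (bound _ (max3 a b (- c))); first exact: le_trans c2 le2.
by case: max3P => _ _; [left|left|right]; lra.
Qed.

(** In a compact set, a sequence with a single accumulation point converges to
it; the accumulation points are known from [add_graph_cluster]. *)
Lemma deformed_add_cvg a b c : trop_add a b = [set c] ->
  deformed_add (kappa ^+ m) a b @[m --> \oo] --> c.
Proof.
move=> abc; set T := fun m => deformed_add (kappa ^+ m) a b.
have clusterT d : cluster (T @ \oo) d -> d = c.
  move=> Td; suff : trop_add a b d by rewrite abc.
  apply: (@add_graph_cluster (fun m => ((a, b), T m)) ((a, b), d)) => //.
  by apply: cluster_pair => //; exact: cvg_cst.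
pose B := 2 * (`|a| + `|b|) + `|c| + 1.
pose V : set R := [set` `[- B, B]].
have TB : (T @ \oo) V.
  apply: (@filterE nat \oo) => m; rewrite /V /= in_itv /= -ler_norml.
  have := deformed_add_bound m a b; rewrite /B -/(T m) => le.
  by apply: (le_trans le); rewrite -addrA lerDl addr_ge0.
apply: (@compact_cluster_set1 _ c _ V) => //.
- exact: segment_compact.
- have : c \in `]- B, B[.
    rewrite in_itv /= -ltr_norml /B ltr_pwDr // lerDr mulr_ge0 // addr_ge0 //.
  move=> /near_in_itvoo; apply: filterS => r /=.
  by rewrite /V /= !in_itv /= => /andP[/ltW -> /ltW ->].
- apply/seteqP; split=> [d /clusterT //|_ ->].
  have [d [_ Td]] := @segment_compact R (- B) B (T @ \oo) _ TB.
  by rewrite -(clusterT d Td).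
Qed.

Lemma cvg_triple (f g h : nat -> R) a b c :
  f @ \oo --> a -> g @ \oo --> b -> h @ \oo --> c ->
  (f m, g m, h m) @[m --> \oo] --> (a, b, c).
Proof.
move=> fa gb hc; apply: (@cvg_pair _ _ _ _ (nbhs (a, b)) (nbhs c)) => //.
exact: (@cvg_pair _ _ _ _ (nbhs a) (nbhs b)).
Qed.

(** Where the tropical sum is multivalued, [b = - a], it is the first or the
second argument that has to be moved, not the sum. *)
Lemma add_graph_approx p : trop_graph p ->
  exists u : nat -> R * R * R,
    (forall m, add_graph kappa m (u m)) /\ u @ \oo --> p.
Proof.
case: p => -[a b] c; rewrite /trop_graph /= => abc.
have [e|ab0] := eqVneq (a + b) 0; last first.
  exists (fun m => (a, b, deformed_add (kappa ^+ m) a b)); split=> //.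
  apply: cvg_triple; [exact: cvg_cst|exact: cvg_cst|apply: deformed_add_cvg].
  case: (leP `|b| `|a|) => [ba|/ltW ab].
    by move: abc; rewrite trop_add_dominant // => ->.
  by move: abc; rewrite trop_addC trop_add_dominant 1?addrC // => ->.
have kV m : (kappa ^+ m) != 0 by rewrite gt_eqF ?exprn_gt0.
have {e}eb : b = - a by apply/eqP; rewrite -addr_eq0 addrC e.
have : `|c| <= `|a|.
  by move: abc; rewrite eb => -[[_ ->]|[_ ->]|[_]];
    rewrite ?normrN ?in_itv /= -?ler_norml.
(* The sum [c - a] is the singleton [- a] unless [c = a]. *)
rewrite eb => ca; have [->|neq_ca] := eqVneq c a.
  exists (fun m => (spow (kappa ^+ m) 2 * a, - a, a)); split=> [m|].
    rewrite /add_graph /= spowM spowK // spowN -[X in spow _ (_ - X)]mul1r.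
    by rewrite -mulrBl addrK mul1r spowVK.
  apply: cvg_triple; [|exact: cvg_cst|exact: cvg_cst].
  by rewrite -[X in _ --> X]mul1r; apply: cvgMr_tmp; exact: spow2_cvg1.
exists (fun m => (a, deformed_add (kappa ^+ m) c (- a), c)); split=> [m|].
  by rewrite /add_graph /= spowK // spowN addrC subrK spowVK.
apply: cvg_triple; [exact: cvg_cst| |exact: cvg_cst].
apply: deformed_add_cvg; rewrite trop_addC trop_add_dominant ?normrN //.
by rewrite addrC subr_eq0.
Qed.

Lemma add_graph_PK_cvg : PK_cvg (@add_graph R kappa) trop_graph.
Proof.
split=> [p|u p Gu]; last exact: add_graph_cluster Gu.
split=> [|[u [Gu up]]]; first exact: add_graph_approx.
apply: add_graph_cluster Gu _ => A B uA /up uB.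
exact: filter_ex (filterI uA uB).
Qed.

Lemma add_graph_closed m : closed (@add_graph R kappa m).
Proof.
have km_gt0 : 0 < kappa ^+ m by rewrite exprn_gt0.
have spow_comp_cont lam (f : R * R * R -> R) :
    0 < lam -> continuous f -> continuous (fun q => spow lam (f q)).
  by move=> lam0 fc q; apply: continuous_comp; [exact: fc|exact: spow_continuous].
have c1 : continuous (fun q : R * R * R => q.1.1).
  by move=> q; apply: continuous_comp; exact: cvg_fst.
have c2 : continuous (fun q : R * R * R => q.1.2).
  by move=> q; apply: continuous_comp; [exact: cvg_fst|exact: cvg_snd].
have sum_cont : continuous (fun q : R * R * R =>
    spow (kappa ^- m) q.1.1 + spow (kappa ^- m) q.1.2).
  by move=> q; apply: cvgD; apply: spow_comp_cont; rewrite ?invr_gt0.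
rewrite (_ : add_graph _ _ = (fun q => q.2 - spow (kappa ^+ m)
    (spow (kappa ^- m) q.1.1 + spow (kappa ^- m) q.1.2)) @^-1` [set r | r = 0]).
  apply: closed_comp => [q _|]; last exact: closed_eq.
  by apply: continuousB; [exact: cvg_snd|exact: spow_comp_cont].
apply/seteqP; split=> q /= => [->|/eqP]; first by rewrite subrr.
by rewrite subr_eq0 => /eqP.
Qed.

End DeformedAddition.

(** * Transport of hyperfield structures *)

(** As [f] is injective, [haddH x y z] amounts to [haddK (f x) (f y) (f z)],
and each axiom of [H] is the axiom of [K] read through [f]. *)
Lemma hyperfield_transfer (H K : Type) (zeroH oneH : H) (mulH : H -> H -> H)
    (haddH : H -> H -> set H) (zeroK oneK : K) (mulK : K -> K -> K)
    (haddK : K -> K -> set K) (f : H -> K) :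
  is_hyperfield_iso zeroH oneH mulH haddH zeroK oneK mulK haddK f ->
  is_hyperfield zeroK oneK mulK haddK -> is_hyperfield zeroH oneH mulH haddH.
Proof.
move=> [[g fK gK] f0 f1 fM fD] [one0 mulA mulC mul1 mul0 mul_neq0 inv nonempty].
move=> addC addA add0 opp reversible mulD.
have f_inj := can_inj fK.
have fDE x y z : haddH x y z <-> haddK (f x) (f y) (f z).
  by rewrite -fD; split=> [|[z' + /f_inj <-]] //; exists z.
have f_neq0 x : x <> zeroH -> f x <> zeroK by rewrite -f0 => x0 /f_inj.
have hadd_ext x y x' y' : haddK (f x) (f y) = haddK (f x') (f y') ->
    haddH x y = haddH x' y'.
  move=> e; apply/seteqP.
  by split=> z /fDE xyz; apply/fDE; [rewrite -e|rewrite e].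
have assoc x y z w : (exists2 s, haddH x y s & haddH s z w) <->
    (exists2 s, haddH x s w & haddH y z s).
  have := addA (f x) (f y) (f z) => /seteqP[sub1 sub2]; split.
    move=> [s /fDE xys /fDE szw].
    have [|_ -> [s' yzs' xs'w]] := sub1 (f w).
      by exists (f s) => //; exists (f z).
    by exists (g s'); apply/fDE; rewrite gK.
  move=> [s /fDE xsw /fDE yzs].
  have [|s' xys' [_ -> s'zw]] := sub2 (f w).
    by exists (f x) => //; exists (f s).
  by exists (g s'); apply/fDE; rewrite gK.
split.
- by move/(congr1 f); rewrite f0 f1.
- by move=> x y z; apply: f_inj; rewrite !fM mulA.
- by move=> x y; apply: f_inj; rewrite !fM mulC.
- by move=> x; apply: f_inj; rewrite fM f1 mul1.
- by move=> x; apply: f_inj; rewrite fM f0 mul0.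
- move=> x y /f_neq0 x0 /f_neq0 y0 /(congr1 f); rewrite fM f0; exact: mul_neq0.
- move=> x /f_neq0 /inv[y y0 xy]; exists (g y).
    by move/(congr1 f); rewrite gK f0.
  by apply: f_inj; rewrite fM gK f1.
- move=> x y; have [z xyz] := nonempty (f x) (f y); exists (g z).
  by apply/fDE; rewrite gK.
- by move=> x y; apply: hadd_ext; rewrite addC.
- move=> x y z; apply/seteqP; split=> w.
    move=> [s xys [_ -> szw]].
    have [|s' xs'w yzs'] := (assoc x y z w).1; first by exists s.
    by exists x => //; exists s'.
  move=> [_ -> [s yzs xsw]].
  have [|s' xys' s'zw] := (assoc x y z w).2; first by exists s.
  by exists s' => //; exists z.
- move=> x; apply/seteqP; split=> y; first by move/fDE; rewrite f0 add0 => /f_inj.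
  by move=> ->; apply/fDE; rewrite f0 add0.
- move=> x; have [y [xy uniq_y]] := opp (f x); exists (g y); split.
    by apply/fDE; rewrite gK f0.
  by move=> y' /fDE; rewrite f0 => /uniq_y ->.
- move=> x y z y' /fDE yy' /fDE yzx; apply/fDE.
  by apply: reversible yzx; rewrite -f0.
- move=> x y z; apply/seteqP; split=> [_ [w /fDE yzw <-]|w /fDE].
    by apply/fDE; rewrite !fM -mulD; exists (f w).
  rewrite !fM -mulD => -[v yzv xv]; exists (g v); first by apply/fDE; rewrite gK.
  by apply: f_inj; rewrite fM gK.
Qed.

(** * The sequences of iterated roots *)

Section Fseq.
Variables (R : realType) (kappa : rat).
Hypotheses (kappa_gt0 : 0 < kappa) (kappa_lt1 : kappa < 1).
Implicit Types x y z : Fseq R kappa.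

Let kappa0 : kappa != 0. Proof. by rewrite gt_eqF. Qed.

Lemma Fseq_root x m n : x (n + m)%N = spow (kappa ^- m) (x n).
Proof.
elim: m => [|m IH]; first by rewrite addn0 expr0 invr1 spow_1l.
rewrite exprS invfM -spow_comp -IH addnS -(FvalP x (n + m)) spowK //.
Qed.

Lemma Fseq_of_subproof (t : R) n :
  spow kappa (spow (kappa ^- n.+1) t) = spow (kappa ^- n) t.
Proof. by rewrite exprS invfM spow_comp mulVKf. Qed.

Definition Fseq_of (t : R) : Fseq R kappa := MkFseq (Fseq_of_subproof t).

Lemma Fseq_eq x y : x =1 y -> x = y.
Proof.
case: x y => [x xP] [y yP] /= /funext exy.
by move: yP; rewrite -exy => yP; rewrite (Prop_irrelevance xP yP).
Qed.

Lemma Fseq_ofK : cancel Fseq_of (@ev0 R kappa).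
Proof. by move=> t; rewrite /ev0 /= expr0 invr1 spow_1l. Qed.

Lemma ev0K : cancel (@ev0 R kappa) Fseq_of.
Proof. by move=> x; apply: Fseq_eq => n; rewrite -[in RHS](add0n n) Fseq_root. Qed.

Lemma ev0_bij : bijective (@ev0 R kappa).
Proof. by exists Fseq_of; [exact: ev0K|exact: Fseq_ofK]. Qed.

Lemma Fseq_ev0 x n : x n = spow (kappa ^- n) (ev0 x).
Proof. by rewrite -Fseq_root add0n. Qed.

Lemma Fadd_approxE x y n m :
  Fadd_approx x y n m = deformed_add (kappa ^+ m) (x n) (y n).
Proof. by rewrite /Fadd_approx !Fseq_root. Qed.

(** The pointwise limit of the approximants, read off from the entry of index
[0], where opposite terms and comparisons of absolute values are those of every
index. *)
Definition Flim_add x y : Fseq R kappa :=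
  if ev0 x + ev0 y == 0 then Fzero R kappa
  else if `|ev0 y| <= `|ev0 x| then x else y.

Lemma Flim_addP x y n : Fadd_approx x y n @ \oo --> Flim_add x y n.
Proof.
have mono l : 0 < l -> {mono @spow R l : s t / s <= t} := @spow_mono_le R l.
have kn_gt0 : 0 < kappa ^- n by rewrite invr_gt0 exprn_gt0.
rewrite (funext (Fadd_approxE x y n)).
rewrite /Flim_add !(fun_if (fun z : Fseq R kappa => z n)) /=.
have -> : (ev0 x + ev0 y == 0) = (x n + y n == 0).
  rewrite !addr_eq0 !Fseq_ev0 -spowN.
  by rewrite (inj_eq (can_inj (spowK (lt0r_neq0 kn_gt0)))).
have -> : (`|ev0 y| <= `|ev0 x|) = (`|y n| <= `|x n|).
  by rewrite !Fseq_ev0 !norm_spow mono.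
have [e|xy0] := eqVneq (x n + y n) 0.
  have -> : y n = - x n by apply/eqP; rewrite -addr_eq0 addrC e.
  rewrite /deformed_add; under eq_fun do rewrite spowN subrr spow0.
  exact: cvg_cst.
apply: deformed_add_cvg => //; case: (leP `|y n| `|x n|) => [yx|/ltW xy].
  exact: trop_add_dominant.
by rewrite trop_addC trop_add_dominant // addrC.
Qed.

Lemma Flim_add_not_assoc : ~ associative Flim_add.
Proof.
move=> /(_ (Fone R kappa) (Fone R kappa) (Fseq_of (- 1))).
have ev1 : ev0 (Fone R kappa) = 1 by [].
have -> : Flim_add (Fone R kappa) (Fone R kappa) = Fone R kappa.
  by rewrite /Flim_add ev1 -mulr2n pnatr_eq0 lexx.
have -> : Flim_add (Fone R kappa) (Fseq_of (- 1)) = Fzero R kappa.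
  by rewrite /Flim_add ev1 Fseq_ofK addrN eqxx.
have -> : Flim_add (Fone R kappa) (Fzero R kappa) = Fone R kappa.
  by rewrite /Flim_add ev1 /ev0 /= addr0 oner_eq0 normr0 normr_ge0.
by move=> /(congr1 (@ev0 R kappa))/eqP; rewrite ev1 /ev0 /= oner_eq0.
Qed.

Lemma PK_cvg_unique (T : topologicalType) (G : nat -> set T) (L L' : set T) :
  PK_cvg G L -> PK_cvg G L' -> L = L'.
Proof.
move=> [GL _] [GL' _]; apply/seteqP.
by split=> p Lp; [apply/GL'/GL|apply/GL/GL'].
Qed.

Lemma FgraphE (hadd : Fseq R kappa -> Fseq R kappa -> set (Fseq R kappa)) x y z :
  Fgraph hadd (ev0 x, ev0 y, ev0 z) <-> hadd x y z.
Proof.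
have ev0_inj := can_inj ev0K.
split=> [[x' [y' [z' [+ [/ev0_inj -> /ev0_inj -> /ev0_inj ->]]]]]//|xyz].
by exists x, y, z.
Qed.

Definition Fhadd x y : set (Fseq R kappa) :=
  [set z | trop_add (ev0 x) (ev0 y) (ev0 z)].

Lemma Fgraph_Fhadd : Fgraph Fhadd = @trop_graph R.
Proof.
apply/seteqP; split=> [_ [x [y [z [xyz ->]]]] //|[[a b] c] abc].
exists (Fseq_of a), (Fseq_of b), (Fseq_of c).
by rewrite /Fhadd /mkset !Fseq_ofK.
Qed.

(** A Painleve-Kuratowski limit is unique, and a hyperaddition is determined by
its graph because [ev0] is injective. *)
Lemma PK_cvg_Fgraph hadd :
  PK_cvg (@add_graph R kappa) (Fgraph hadd) <-> hadd = Fhadd.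
Proof.
have lim : PK_cvg (@add_graph R kappa) (Fgraph Fhadd).
  by rewrite Fgraph_Fhadd; exact: add_graph_PK_cvg.
split=> [/PK_cvg_unique/(_ lim) e|-> //].
apply/funext => x; apply/funext => y; apply/seteqP.
by split=> z; rewrite -!FgraphE e.
Qed.

Lemma ev0_hyperfield_iso :
  is_hyperfield_iso (Fzero R kappa) (Fone R kappa) (@Fmul R kappa) Fhadd
    0 1 *%R (@trop_add R) (@ev0 R kappa).
Proof.
split=> //; first exact: ev0_bij.
move=> x y; apply/seteqP; split=> [_ [z xyz <-] //|c xyc].
by exists (Fseq_of c); rewrite ?Fseq_ofK // /Fhadd /mkset Fseq_ofK.
Qed.

Lemma Fhadd_multivalued : multivalued Fhadd.
Proof.
have [a [b [c [d [abc abd cd]]]]] := trop_multivalued R.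
exists (Fseq_of a), (Fseq_of b), (Fseq_of c), (Fseq_of d).
by rewrite /Fhadd /mkset !Fseq_ofK; split=> // /(can_inj Fseq_ofK).
Qed.

End Fseq.

Theorem theorem2p1 (R : realType) (kappa : rat)
    (kappa_gt0 : 0 < kappa) (kappa_lt1 : kappa < 1)
    (odd_num : odd `|numq kappa|%N) (odd_den : odd `|denq kappa|%N) :
  [/\ (bijective (@ev0 R kappa) /\
       {morph (@ev0 R kappa) : x y / Fmul x y >-> x * y} /\
       ev0 (Fone R kappa) = 1),
      (exists Fadd : Fseq R kappa -> Fseq R kappa -> Fseq R kappa,
         (forall x y n, Fadd_approx x y n @ \oo --> Fadd x y n) /\
         ~ associative Fadd) &
      [/\ (forall m, closed (@add_graph R kappa m)),
          (exists! hadd : Fseq R kappa -> Fseq R kappa -> set (Fseq R kappa),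
             PK_cvg (@add_graph R kappa) (Fgraph hadd)) &
          (forall hadd : Fseq R kappa -> Fseq R kappa -> set (Fseq R kappa),
             PK_cvg (@add_graph R kappa) (Fgraph hadd) ->
             [/\ multivalued hadd,
                 hassociative hadd,
                 is_hyperfield (Fzero R kappa) (Fone R kappa)
                   (@Fmul R kappa) hadd &
                 is_hyperfield_iso
                   (Fzero R kappa) (Fone R kappa) (@Fmul R kappa) hadd
                   0 1 *%R (@trop_add R) (@ev0 R kappa)])]].
Proof.
have hf := hyperfield_transfer (ev0_hyperfield_iso R kappa_gt0) (trop_hyperfield R).
split.
- by split; [exact: ev0_bij|].
- exists (@Flim_add R kappa); split; first exact: Flim_addP.
  exact: Flim_add_not_assoc.
split.
- exact: add_graph_closed.
- exists (@Fhadd R kappa); split=> [|hadd]; first exact/PK_cvg_Fgraph.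
  by move=> /PK_cvg_Fgraph ->.
move=> hadd /PK_cvg_Fgraph -> //; split=> //.
- exact: Fhadd_multivalued.
- exact: (hf_addA hf).
- exact: ev0_hyperfield_iso.
Qed.
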